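(* Let $\alpha,\beta$ be generators, let $\mathbb C(N)$ be the associated field of $\ast$-complex numbers, let $\mathbb A$ be a $C^{\ast_N}$-algebra, and let $x\in\mathbb A$. Then: (i) If $x$ is $N$-invertible, then $x^{\ast_N}$ is $N$-invertible and $(x^{\ast_N})^{-1_N}=(x^{-1_N})^{\ast_N}$. (ii) $x=u\,\widehat+\,i_{\mathbb C(N)}\,\widehat\cdot\,v$, where $u$ and $v$ are $N$-hermitian elements of $\mathbb A$. (iii) If $x$ is an $N$-unitary element of $\mathbb A$, then $\|x\|_{\mathbb A}=\ddot 1$.
   Context: A generator is an injective function $\mathbb R\to\mathbb R$. For generators $\alpha,\beta$ with ranges $\mathbb R_\alpha,\mathbb R_\beta$, write $\dot a=\alpha(a)$, $\ddot b=\beta(b)$ for $a,b\in\mathbb R$. $\mathbb R_\beta$ carries the ordered field structure transported along $\beta$: $y\ddot+z=\beta(\beta^{-1}(y)+\beta^{-1}(z))$, similarly $\ddot-,\ddot\times,\ddot/$, and $y\mathrel{\ddot\le}z\iff\beta^{-1}(y)\le\beta^{-1}(z)$ (likewise $\mathbb R_\alpha$ with single dots); $y^{\ddot 2}=y\ddot\times y$. $\mathbb C(N)=\{(\dot a,\ddot b):a,b\in\mathbb R\}$ is a field under $(\dot a_1,\ddot b_1)\oplus(\dot a_2,\ddot b_2)=(\alpha(a_1+a_2),\beta(b_1+b_2))$ and $(\dot a_1,\ddot b_1)\odot(\dot a_2,\ddot b_2)=(\alpha(a_1a_2-b_1b_2),\beta(a_1b_2+b_1a_2))$, with zero $(\dot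 0,\ddot 0)$, unit $1_{\mathbb C(N)}=(\dot 1,\ddot 0)$, and $i_{\mathbb C(N)}=(\dot 0,\ddot 1)$. Its norm is $\ddot\|(\dot a,\ddot b)\ddot\|=\beta(\sqrt{a^2+b^2})\in\mathbb R_\beta$, and conjugation is $\overline{(\dot a,\ddot b)}=(\dot a,\beta(-b))$. A $\mathbb C(N)$-algebra is a vector space $\mathbb A$ over the field $\mathbb C(N)$ (operations $\widehat+,\widehat\cdot$) with an associative multiplication $\widehat\times$, distributive over $\widehat+$ on both sides, such that $\lambda\widehat\cdot(x\widehat\times y)=x\widehat\times(\lambda\widehat\cdot y)=(\lambda\widehat\cdot x)\widehat\times y$. A unit is an element $1_{\mathbb A}^N$ with $x\widehat\times 1_{\mathbb A}^N=1_{\mathbb A}^N\widehat\times x=x$ for all $x$. A norm on $\mathbb A$ is a map $\|\cdot\|_{\mathbb A}:\mathbb A\to\mathbb R_\beta$ such that $\|x\|_{\mathbb A}=\ddot 0$ implies $x=0$, $\|\lambda\widehat\cdot x\|_{\mathbb A}=\ddot\|\lambda\ddot\|\ddot\times\|x\|_{\mathbb A}$, and $\|x\widehat+y\|_{\mathbb A}\mathrel{\ddot\le}\|x\|_{\mathbb A}\ddot+\|y\|_{\mathbb A}$. A Banach $\mathbb C(N)$-algebra is a $\mathbb C(N)$-algebra with a norm satisfying $\|x\widehat\times y\|_{\mathbb A}\mathrel{\ddot\le}\|x\|_{\mathbb A}\ddot\times\|y\|_{\mathbb A}$ and complete (every Cauchy sequence converges, where convergence and the Cauchy property are defined by the usual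 $\varepsilon$-conditions with $\varepsilon\in\mathbb R_\beta$, $\varepsilon\mathrel{\ddot>}\ddot 0$). An $N$-involution on $\mathbb A$ is a map $\mathbb A\to\mathbb A$, $x\mapsto x^{\ast_N}$, with $(x\widehat+y)^{\ast_N}=x^{\ast_N}\widehat+y^{\ast_N}$, $(\lambda\widehat\cdot x)^{\ast_N}=\overline\lambda\,\widehat\cdot\,x^{\ast_N}$, $(x\widehat\times y)^{\ast_N}=y^{\ast_N}\widehat\times x^{\ast_N}$, $(x^{\ast_N})^{\ast_N}=x$. A $C^{\ast_N}$-algebra is a Banach $\mathbb C(N)$-algebra with an $N$-involution such that $\|x^{\ast_N}\widehat\times x\|_{\mathbb A}=\|x\|_{\mathbb A}^{\ddot 2}$ for all $x$. An element $x$ is $N$-hermitian if $x=x^{\ast_N}$. The following two notions are used only when $\mathbb A$ has a unit $1_{\mathbb A}^N$ (so (i) and (iii) concern unital $\mathbb A$): $x$ is $N$-invertible if there is $y\in\mathbb A$ with $x\widehat\times y=y\widehat\times x=1_{\mathbb A}^N$, this unique $y$ being denoted $x^{-1_N}$; and $x$ is $N$-unitary if $x\widehat\times x^{\ast_N}=x^{\ast_N}\widehat\times x=1_{\mathbb A}^N$.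
   Formalization: In (iii) the algebra is assumed nonzero (its unit is not 0): in the zero algebra x = 0 is N-unitary but has norm β(0), not β(1), so (iii) fails there; this is the only case excluded. *)

(* Defs.v *)
From HB Require Import structures.
From mathcomp Require Import all_boot all_order all_algebra.
From mathcomp Require Import all_classical all_reals.
From mathcomp Require Import ring.

Set Implicit Arguments.
Unset Strict Implicit.
Unset Printing Implicit Defensive.

Import Order.TTheory GRing.Theory Num.Theory.
Local Open Scope classical_set_scope.
Local Open Scope ring_scope.

(* A generator is an injective, possibly discontinuous, function R -> R. *)
Notation generator R := {inj [set: R] >-> R}.

Section GeneratedReals.
Context {R : realType} (g : generator R).

(* The elements of the range R_g of g. The operations and the order on [nreal]
   are the dotted ones, transported along g, and not those of R. *)
Record nreal := NReal { nval : R ; _ : nval \in range g }.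

HB.instance Definition _ := [isSub for nval].
HB.instance Definition _ := [Choice of nreal by <:].

Fact ndot_subproof (a : R) : g a \in range g.
Proof. by apply/mem_set; exists a. Qed.

Definition ndot (a : R) : nreal := NReal (ndot_subproof a).

(* g^-1 on the range of g; the default value 0 is never reached. *)
Definition nundot (y : nreal) : R := xget 0 (g @^-1` [set nval y]).

Lemma nundotK : cancel nundot ndot.
Proof.
move=> y; apply: val_inj => /=; rewrite /nundot.
case: xgetP => [b _ //|H].
by have /set_mem [b _ Eb] := valP y; case: (H b).
Qed.

Lemma ndotK : cancel ndot nundot.
Proof.
move=> a; rewrite /nundot; apply: xget_unique => //= b E.
by apply: (@inj _ _ _ g); rewrite ?in_setT.
Qed.

Definition nreal_add y z := ndot (nundot y + nundot z).
Definition nreal_opp y := ndot (- nundot y).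
Definition nreal_mul y z := ndot (nundot y * nundot z).
Definition nreal_inv y := ndot (nundot y)^-1.
Definition nreal_le y z := nundot y <= nundot z.
Definition nreal_lt y z := nundot y < nundot z.
Definition nreal_abs y := ndot `|nundot y|.

Fact nreal_addA : associative nreal_add.
Proof. by move=> x y z; rewrite /nreal_add !ndotK addrA. Qed.
Fact nreal_addC : commutative nreal_add.
Proof. by move=> x y; rewrite /nreal_add addrC. Qed.
Fact nreal_add0 : left_id (ndot 0) nreal_add.
Proof. by move=> x; rewrite /nreal_add ndotK add0r nundotK. Qed.
Fact nreal_addN : left_inverse (ndot 0) nreal_opp nreal_add.
Proof. by move=> x; rewrite /nreal_add /nreal_opp ndotK addNr. Qed.
HB.instance Definition _ := GRing.isZmodule.Build nreal
  nreal_addA nreal_addC nreal_add0 nreal_addN.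

Fact nreal_mulA : associative nreal_mul.
Proof. by move=> x y z; rewrite /nreal_mul !ndotK mulrA. Qed.
Fact nreal_mulC : commutative nreal_mul.
Proof. by move=> x y; rewrite /nreal_mul mulrC. Qed.
Fact nreal_mul1 : left_id (ndot 1) nreal_mul.
Proof. by move=> x; rewrite /nreal_mul ndotK mul1r nundotK. Qed.
Fact nreal_mulDl : left_distributive nreal_mul nreal_add.
Proof. by move=> x y z; rewrite /nreal_mul /nreal_add !ndotK mulrDl. Qed.
Fact nreal_one_neq0 : ndot 1 != ndot 0.
Proof. by rewrite (can_eq ndotK) oner_neq0. Qed.
HB.instance Definition _ := GRing.Zmodule_isComNzRing.Build nreal
  nreal_mulA nreal_mulC nreal_mul1 nreal_mulDl nreal_one_neq0.

Fact nreal_mulV (y : nreal) : y != 0 -> nreal_mul (nreal_inv y) y = 1.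
Proof.
move=> y0; rewrite /nreal_mul /nreal_inv ndotK mulVf //.
by rewrite -(can_eq ndotK) nundotK.
Qed.
Fact nreal_inv0 : nreal_inv 0 = 0.
Proof. by rewrite /nreal_inv ndotK invr0. Qed.
HB.instance Definition _ :=
  GRing.ComNzRing_isField.Build nreal nreal_mulV nreal_inv0.

Fact nreal_le0_add (y z : nreal) :
  nreal_le 0 y -> nreal_le 0 z -> nreal_le 0 (y + z).
Proof. by rewrite /nreal_le !ndotK; exact: addr_ge0. Qed.
Fact nreal_le0_mul (y z : nreal) :
  nreal_le 0 y -> nreal_le 0 z -> nreal_le 0 (y * z).
Proof. by rewrite /nreal_le !ndotK; exact: mulr_ge0. Qed.
Fact nreal_le0_anti (y : nreal) : nreal_le 0 y -> nreal_le y 0 -> y = 0.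
Proof.
rewrite /nreal_le ndotK => y0 y0'; apply: (can_inj nundotK); rewrite ndotK.
by apply/eqP; rewrite eq_le y0 y0'.
Qed.
Fact nreal_sub_ge0 (y z : nreal) : nreal_le 0 (z - y) = nreal_le y z.
Proof. by rewrite /nreal_le !ndotK subr_ge0. Qed.
Fact nreal_le0_total (y : nreal) : nreal_le 0 y || nreal_le y 0.
Proof. exact: le_total. Qed.
Fact nreal_absN (y : nreal) : nreal_abs (- y) = nreal_abs y.
Proof. by rewrite /nreal_abs ndotK normrN. Qed.
Fact nreal_ge0_abs (y : nreal) : nreal_le 0 y -> nreal_abs y = y.
Proof. by rewrite /nreal_le /nreal_abs ndotK => /ger0_norm->; rewrite nundotK. Qed.
Fact nreal_lt_def (y z : nreal) : nreal_lt y z = (z != y) && nreal_le y z.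
Proof. by rewrite /nreal_lt lt_def (can_eq nundotK). Qed.
HB.instance Definition _ := Num.IntegralDomain_isLeReal.Build nreal
  nreal_le0_add nreal_le0_mul nreal_le0_anti nreal_sub_ge0 nreal_le0_total
  nreal_absN nreal_ge0_abs nreal_lt_def.

End GeneratedReals.

Section StarComplex.
Context {R : realType} (alpha beta : generator R).

(* C(N): the pairs (alpha a, beta b); [sre] and [sim] below give back the real
   numbers a and b. *)
Record starC := StarC { sfst : nreal alpha ; ssnd : nreal beta }.

Definition starC_pair (z : starC) := (sfst z, ssnd z).
Definition pair_starC (p : nreal alpha * nreal beta) := StarC p.1 p.2.
Fact starC_pairK : cancel starC_pair pair_starC. Proof. by case. Qed.
HB.instance Definition _ := Choice.copy starC (can_type starC_pairK).

Definition mkstarC (a b : R) : starC := StarC (ndot alpha a) (ndot beta b).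
Definition sre (z : starC) : R := nundot (sfst z).
Definition sim (z : starC) : R := nundot (ssnd z).

Definition starC_add z w := mkstarC (sre z + sre w) (sim z + sim w).
Definition starC_opp z := mkstarC (- sre z) (- sim z).
Definition starC_mul z w :=
  mkstarC (sre z * sre w - sim z * sim w) (sre z * sim w + sim z * sre w).
Definition starC_inv z :=
  mkstarC (sre z / (sre z ^+ 2 + sim z ^+ 2))
          (- sim z / (sre z ^+ 2 + sim z ^+ 2)).

Definition starCi : starC := mkstarC 0 1.
Definition starC_norm (z : starC) : nreal beta :=
  ndot beta (Num.sqrt (sre z ^+ 2 + sim z ^+ 2)).
Definition starC_conj (z : starC) : starC :=
  StarC (sfst z) (ndot beta (- sim z)).

Lemma sre_mk a b : sre (mkstarC a b) = a. Proof. exact: ndotK. Qed.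
Lemma sim_mk a b : sim (mkstarC a b) = b. Proof. exact: ndotK. Qed.
Lemma mkstarCK z : mkstarC (sre z) (sim z) = z.
Proof. by case: z => y z; rewrite /mkstarC /sre /sim /= !nundotK. Qed.

Fact starC_addA : associative starC_add.
Proof. by move=> x y z; rewrite /starC_add !(sre_mk, sim_mk) !addrA. Qed.
Fact starC_addC : commutative starC_add.
Proof. by move=> x y; rewrite /starC_add addrC [sim x + _]addrC. Qed.
Fact starC_add0 : left_id (mkstarC 0 0) starC_add.
Proof. by move=> x; rewrite /starC_add sre_mk sim_mk !add0r mkstarCK. Qed.
Fact starC_addN : left_inverse (mkstarC 0 0) starC_opp starC_add.
Proof. by move=> x; rewrite /starC_add sre_mk sim_mk !addNr. Qed.
HB.instance Definition _ := GRing.isZmodule.Build starC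
  starC_addA starC_addC starC_add0 starC_addN.

Fact starC_mulA : associative starC_mul.
Proof.
by move=> x y z; rewrite /starC_mul !(sre_mk, sim_mk); congr mkstarC; ring.
Qed.
Fact starC_mulC : commutative starC_mul.
Proof. by move=> x y; rewrite /starC_mul; congr mkstarC; ring. Qed.
Fact starC_mul1 : left_id (mkstarC 1 0) starC_mul.
Proof.
move=> x; rewrite /starC_mul sre_mk sim_mk -[RHS]mkstarCK.
by congr mkstarC; ring.
Qed.
Fact starC_mulDl : left_distributive starC_mul starC_add.
Proof.
move=> x y z; rewrite /starC_mul /starC_add !(sre_mk, sim_mk).
by congr mkstarC; ring.
Qed.
Fact starC_one_neq0 : mkstarC 1 0 != mkstarC 0 0.
Proof.
by apply/eqP => /(congr1 sre); rewrite !sre_mk; apply/eqP; exact: oner_neq0.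
Qed.
HB.instance Definition _ := GRing.Zmodule_isComNzRing.Build starC
  starC_mulA starC_mulC starC_mul1 starC_mulDl starC_one_neq0.

Fact starC_mulV (z : starC) : z != 0 -> starC_mul (starC_inv z) z = 1.
Proof.
move=> z0; have n0 : sre z ^+ 2 + sim z ^+ 2 != 0.
  apply: contra z0; rewrite paddr_eq0 ?sqr_ge0// !sqrf_eq0.
  by move=> /andP[/eqP a0 /eqP b0]; rewrite -[z]mkstarCK a0 b0.
rewrite /starC_mul /starC_inv !(sre_mk, sim_mk).
rewrite -[1]/(mkstarC 1 0); congr mkstarC; last by ring.
rewrite -(divff n0); ring.
Qed.
Fact starC_inv0 : starC_inv 0 = 0.
Proof. by rewrite /starC_inv !(sre_mk, sim_mk) oppr0 !mul0r. Qed.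
HB.instance Definition _ :=
  GRing.ComNzRing_isField.Build starC starC_mulV starC_inv0.

End StarComplex.

Arguments starCi {R alpha beta}.

(* Not necessarily unital, hence not [algType]. *)
HB.mixin Record isNAlgebra (R : realType) (alpha beta : generator R) A
    of GRing.Lmodule (starC alpha beta) A := {
  nmul : A -> A -> A ;
  nmulA : associative nmul ;
  nmulDl : left_distributive nmul +%R ;
  nmulDr : right_distributive nmul +%R ;
  nmulZr : forall (l : starC alpha beta) (x y : A),
    l *: nmul x y = nmul x (l *: y) ;
  nmulZl : forall (l : starC alpha beta) (x y : A),
    l *: nmul x y = nmul (l *: x) y ;
}.

#[short(type="nAlgType")]
HB.structure Definition NAlgebra (R : realType) (alpha beta : generator R) :=
  { A of GRing.Lmodule (starC alpha beta) A & isNAlgebra R alpha beta A }.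

HB.mixin Record hasNNorm (R : realType) (alpha beta : generator R) A
    of NAlgebra R alpha beta A := {
  nnorm : A -> nreal beta ;
  nnorm0_eq0 : forall x : A, nnorm x = 0 -> x = 0 ;
  nnormZ : forall (l : starC alpha beta) (x : A),
    nnorm (l *: x) = starC_norm l * nnorm x ;
  nnormD : forall x y : A, nnorm (x + y) <= nnorm x + nnorm y ;
}.

#[short(type="normedNAlgType")]
HB.structure Definition NormedNAlgebra (R : realType)
  (alpha beta : generator R) :=
  { A of NAlgebra R alpha beta A & hasNNorm R alpha beta A }.

Section Sequences.
Context {R : realType} {alpha beta : generator R}.
Variable A : normedNAlgType alpha beta.

Definition ncauchy (u : nat -> A) := forall e : nreal beta, 0 < e ->
  exists n0 : nat, forall m n : nat, (n0 <= m)%N -> (n0 <= n)%N ->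
    nnorm (u m - u n) < e.

Definition nconverges_to (u : nat -> A) (l : A) :=
  forall e : nreal beta, 0 < e ->
  exists n0 : nat, forall n : nat, (n0 <= n)%N -> nnorm (u n - l) < e.

End Sequences.

HB.mixin Record isBanachN (R : realType) (alpha beta : generator R) A
    of NormedNAlgebra R alpha beta A := {
  nnormM : forall x y : A, nnorm (nmul x y) <= nnorm x * nnorm y ;
  ncomplete : forall u : nat -> A, ncauchy u -> exists l, nconverges_to u l ;
}.

#[short(type="banachNAlgType")]
HB.structure Definition BanachNAlgebra (R : realType)
  (alpha beta : generator R) :=
  { A of NormedNAlgebra R alpha beta A & isBanachN R alpha beta A }.

HB.mixin Record hasNInvolution (R : realType) (alpha beta : generator R) A
    of NAlgebra R alpha beta A := {
  nstar : A -> A ;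
  nstarD : forall x y : A, nstar (x + y) = nstar x + nstar y ;
  nstarZ : forall (l : starC alpha beta) (x : A),
    nstar (l *: x) = starC_conj l *: nstar x ;
  nstarM : forall x y : A, nstar (nmul x y) = nmul (nstar y) (nstar x) ;
  nstarK : involutive nstar ;
}.

#[short(type="involutiveNAlgType")]
HB.structure Definition InvolutiveNAlgebra (R : realType)
  (alpha beta : generator R) :=
  { A of NAlgebra R alpha beta A & hasNInvolution R alpha beta A }.

HB.mixin Record isCstarN (R : realType) (alpha beta : generator R) A
    of BanachNAlgebra R alpha beta A & InvolutiveNAlgebra R alpha beta A := {
  nnorm_starM : forall x : A, nnorm (nmul (nstar x) x) = nnorm x ^+ 2 ;
}.

#[short(type="cstarNAlgType")]
HB.structure Definition CstarNAlgebra (R : realType)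
  (alpha beta : generator R) :=
  { A of BanachNAlgebra R alpha beta A & InvolutiveNAlgebra R alpha beta A
       & isCstarN R alpha beta A }.

Section Elements.
Context {R : realType} {alpha beta : generator R}.

Section Inverses.
Variable A : nAlgType alpha beta.

(* A unital algebra is an algebra with an [e] such that [is_nunit e]; the zero
   algebra qualifies, with [e = 0]. *)
Definition is_nunit (e : A) := forall x : A, nmul x e = x /\ nmul e x = x.

Definition is_ninverse (e x y : A) := nmul x y = e /\ nmul y x = e.

Definition ninvertible (e x : A) := exists y : A, is_ninverse e x y.

(* 0 if x is not invertible. *)
Definition ninverse (e x : A) : A := xget 0 [set y | is_ninverse e x y].

Lemma ninverse_unique (e x y : A) :
  is_nunit e -> is_ninverse e x y -> ninverse e x = y.
Proof.
move=> He [xy yx]; apply: xget_unique => //= z [xz zx].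
by rewrite -(He z).1 -xy nmulA zx (He y).2.
Qed.

End Inverses.

Variable A : involutiveNAlgType alpha beta.

Definition nhermitian (x : A) := x = nstar x.

Definition nunitary (e x : A) := nmul x (nstar x) = e /\ nmul (nstar x) x = e.

End Elements.

(* Main.v *)
Require Import Defs.
From HB Require Import structures.
From mathcomp Require Import all_boot all_order all_algebra.
From mathcomp Require Import all_classical all_reals.
From mathcomp Require Import ring.

Import Order.TTheory GRing.Theory Num.Theory.
Local Open Scope ring_scope.

(** The star reverses products and fixes a unit, so it carries an inverse pair to an inverse pair
    ([is_ninverse_star]); uniqueness of inverses then gives (i). For (ii), l x + conj(l) x^* is
    hermitian for every scalar l, and l = 1/2 and l = 1/(2i) give the real and imaginary parts of x.
    For (iii), the C*-identity at a nonzero unit e forces the norm of e to be 1, and at a unitary x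
    it says that the squared norm of x is the norm of e. The hypothesis [e <> 0] excludes the zero
    algebra, where 0 is unitary of norm 0. *)

Section StarComplexConjugation.
Context {R : realType} {alpha beta : generator R}.
Implicit Types (a b : R) (z : starC alpha beta).

Lemma mkstarC_addE a b a' b' :
  mkstarC alpha beta a b + mkstarC alpha beta a' b' =
  mkstarC alpha beta (a + a') (b + b').
Proof. by rewrite [LHS]/(starC_add _ _) /starC_add !(sre_mk, sim_mk). Qed.

Lemma mkstarC_mulE a b a' b' :
  mkstarC alpha beta a b * mkstarC alpha beta a' b' =
  mkstarC alpha beta (a * a' - b * b') (a * b' + b * a').
Proof. by rewrite [LHS]/(starC_mul _ _) /starC_mul !(sre_mk, sim_mk). Qed.

Lemma starC_conj_mk a b :
  starC_conj (mkstarC alpha beta a b) = mkstarC alpha beta a (- b).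
Proof. by rewrite /starC_conj sim_mk. Qed.

Lemma starC_conjK z : starC_conj (starC_conj z) = z.
Proof. by rewrite -[z]mkstarCK !starC_conj_mk opprK. Qed.

Lemma starC_norm0 : starC_norm (0 : starC alpha beta) = 0.
Proof.
by rewrite /starC_norm sre_mk sim_mk expr0n /= addr0 sqrtr0.
Qed.

Lemma starC_normN z : starC_norm (- z) = starC_norm z.
Proof. by rewrite /starC_norm sre_mk sim_mk !sqrrN. Qed.

Lemma starC_norm1 : starC_norm (1 : starC alpha beta) = 1.
Proof.
by rewrite /starC_norm sre_mk sim_mk expr0n expr1n /= addr0 sqrtr1.
Qed.

End StarComplexConjugation.

Section NormedTheory.
Context {R : realType} {alpha beta : generator R}.
Variable A : normedNAlgType alpha beta.
Implicit Types x : A.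

Lemma nnorm0 : nnorm (0 : A) = 0.
Proof. by rewrite -[X in nnorm X](scale0r 0) nnormZ starC_norm0 mul0r. Qed.

Lemma nnormN x : nnorm (- x) = nnorm x.
Proof. by rewrite -scaleN1r nnormZ starC_normN starC_norm1 mul1r. Qed.

(** Positivity is not among the norm axioms; it follows from 0 = ||x - x|| <= ||x|| + ||-x|| = 2
    ||x||. *)
Lemma nnorm_ge0 x : 0 <= nnorm x.
Proof.
by rewrite -(pmulrn_lge0 _ (ltn0Sn 1)) mulr2n -{2}nnormN -nnorm0 -(subrr x) nnormD.
Qed.

End NormedTheory.

Section InvolutionTheory.
Context {R : realType} {alpha beta : generator R}.
Variable A : involutiveNAlgType alpha beta.
Implicit Types (e x y : A) (l : starC alpha beta).

(** The element e e^* is its own star, and it equals e^* because e is a unit; hence e^* = e^** =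
    e. *)
Lemma nstar_unit e : is_nunit e -> nstar e = e.
Proof.
move=> He; rewrite -[LHS](He _).2.
by rewrite -[e in nmul e _]nstarK -nstarM (He _).2 nstarK.
Qed.

Lemma is_ninverse_star e x y :
  is_nunit e -> is_ninverse e x y -> is_ninverse e (nstar x) (nstar y).
Proof.
by move=> /nstar_unit He [xy yx]; split; rewrite -nstarM ?xy ?yx He.
Qed.

(** The star exchanges the two summands. *)
Lemma nhermitian_scale_conj l x :
  nhermitian (l *: x + starC_conj l *: nstar x).
Proof. by rewrite /nhermitian nstarD !nstarZ nstarK starC_conjK addrC. Qed.

(* u = (x + x^* ) / 2 and v = (x - x^* ) / 2i are both of the form
   l x + conj l x^*. *)
Lemma nhermitian_decomposition x :
  exists u v, [/\ nhermitian u, nhermitian v & x = u + starCi *: v].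
Proof.
pose h := mkstarC alpha beta 2^-1 0; pose k := mkstarC alpha beta 0 (- 2^-1).
exists (h *: x + starC_conj h *: nstar x), (k *: x + starC_conj k *: nstar x).
split; [exact: nhermitian_scale_conj | exact: nhermitian_scale_conj |].
(* Collect coefficients: x gets h + i k = 1/2 + 1/2 = 1, and x^* gets conj(h) + i conj(k) = 1/2 -
   1/2 = 0. *)
rewrite scalerDr !scalerA addrACA -!scalerDl !starC_conj_mk.
rewrite !mkstarC_mulE !mkstarC_addE.
rewrite [mkstarC _ _ _ _ in X in X + _](_ : _ = 1); last first.
  by rewrite -[RHS]/(mkstarC alpha beta 1 0); congr mkstarC; field.
rewrite [mkstarC _ _ _ _](_ : _ = 0); last first.
  by rewrite -[RHS]/(mkstarC alpha beta 0 0); congr mkstarC; ring.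
by rewrite scale1r scale0r addr0.
Qed.

End InvolutionTheory.

Section CstarTheory.
Context {R : realType} {alpha beta : generator R}.
Variable A : cstarNAlgType alpha beta.
Implicit Types e x : A.

(** Since e^* e = e, the C*-identity reads ||e|| = ||e||^2, and ||e|| cancels because e is
    nonzero. *)
Lemma nnorm_unit e : is_nunit e -> e <> 0 -> nnorm e = 1.
Proof.
move=> He e0; have := nnorm_starM e.
rewrite nstar_unit // (He e).1 expr2 -{1}[nnorm e]mulr1 => /esym.
by apply: mulfI; apply/eqP => /nnorm0_eq0.
Qed.

Lemma nnorm_unitary e x :
  is_nunit e -> e <> 0 -> nunitary e x -> nnorm x = 1.
Proof.
move=> He e0 [_ xx]; have /esym/eqP := nnorm_starM x.
(* Of the two roots of t^2 = 1, nonnegativity of the norm leaves only 1. *)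
by rewrite xx (nnorm_unit e) // sqrp_eq1 ?nnorm_ge0 // => /eqP.
Qed.

End CstarTheory.

Theorem proposition4 (R : realType) (alpha beta : generator R)
    (A : cstarNAlgType alpha beta) (x : A) :
  (forall e : A, is_nunit e -> ninvertible e x ->
     ninvertible e (nstar x) /\ ninverse e (nstar x) = nstar (ninverse e x)) /\
  (exists u v : A, [/\ nhermitian u, nhermitian v & x = u + starCi *: v]) /\
  (forall e : A, is_nunit e -> e <> 0 -> nunitary e x ->
     nnorm x = ndot beta 1).
Proof.
split; last split.
- move=> e He [y xy]; have xy' := is_ninverse_star _ _ _ _ He xy.
  split; first by exists (nstar y).
  (* Both [ninverse] terms are choices with default 0; the exhibited inverses y and y^* determine
     their values. *)
  by rewrite (ninverse_unique He xy) (ninverse_unique He xy').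
- exact: nhermitian_decomposition.
- by move=> e He e0 /(nnorm_unitary _ _ _ He e0).
Qed.
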